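(* Fix $p\in[0,1]$. For $n\ge0$ let $$P'_n(x,y,z,w)=\sum_{\pi\in[n]^n}\mathbb E\big[x^{\mathrm{unl}}y^{\mathrm{dis}}z^{\mathrm{des}}w^{\mathrm{rlm}}\,\mathbf 1\{\text{all $n$ cars park}\}\big],$$ with $P'_0=1$, where the expectation is over the coin flips of the probabilistic parking protocol with preference vector $\pi$ on a street with $n$ spots. Then for $n\ge1$, $$P'_n(x,y,z,w)=\big(1+p(xy+\cdots+xy^{n-1})\big)wP'_{n-1}(x,y,z,1)+\sum_{i=0}^{n-2}\binom{n-1}{i}\big(1+p(xy+\cdots+xy^{i})+(1-p)(xy+\cdots+xy^{n-i-1})\big)zw\,P'_i(x,y,z,1)\,P'_{n-i-1}(x,y,z,w).$$
   Context: Probabilistic parking protocol with parameter $p\in[0,1]$: spots $1,\dots,N$ on a street; cars $1,\dots,m$ arrive in order with preferences $\pi\in[N]^m$. A car goes to its preferred spot and parks there if it is unoccupied. Otherwise it flips an independent coin: with probability $p$ it moves forward and parks in the first unoccupied spot with larger label, with probability $1-p$ it moves backward and parks in the first unoccupied spot with smaller label; if there is no unoccupied spot in the chosen direction the car fails to park. (For $p=1$ this is the classical protocol.) On the event that all cars park, let $b_i$ be the spot of car $i$; $\mathrm{oc}=b_1\cdots b_m$. $\mathrm{unl}$ = number of cars with $b_i\ne\pi_i$; $\mathrm{dis}=\sum_i|b_i-\pi_i|$; when $m=N=n$, $\mathrm{des}$ and $\mathrm{rlm}$ are the numbers of descents (indices $i$ with $c_i>c_{i+1}$) and right-to-left maxima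 (indices $i$ with $c_i>c_j$ for all $j>i$) of $\mathrm{oc}^{-1}=c_1\cdots c_n$. *)

(* Defs.v *)
From mathcomp Require Import all_boot all_order all_algebra.

Set Implicit Arguments.
Unset Strict Implicit.
Unset Printing Implicit Defensive.

Import Order.TTheory GRing.Theory Num.Theory.
Local Open Scope ring_scope.

(* Spots and cars are labelled from 0 rather than from 1; all the statistics  *)
(* below only depend on differences and comparisons of labels.                *)

(* [heads] is the outcome of the car's coin: [true] means forward.  It is     *)
(* ignored when the preferred spot is free.  [None]: the car fails to park.   *)
Definition park_car (N : nat) (occ : {set 'I_N}) (pref : 'I_N) (heads : bool) :
    option 'I_N :=
  if pref \notin occ then Some pref
  else if heads then
    ohead [seq s : 'I_N <- enum 'I_N | (pref < s)%N && (s \notin occ)]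
  else
    ohead (rev [seq s : 'I_N <- enum 'I_N | (s < pref)%N && (s \notin occ)]).

(* [Some [:: b_1; ...; b_m]] when all the cars park, [None] as soon as one of *)
(* them fails to.                                                             *)
Fixpoint park_cars (N : nat) (occ : {set 'I_N}) (cars : seq ('I_N * bool)) :
    option (seq 'I_N) :=
  if cars is (pref, heads) :: cars' then
    if park_car occ pref heads is Some b then
      omap (cons b) (park_cars (b |: occ) cars')
    else None
  else Some [::].

Definition outcome (m N : nat) (pi : m.-tuple 'I_N) (coins : m.-tuple bool) :
    option (seq 'I_N) :=
  park_cars set0 (zip pi coins).

Definition unl (N : nat) (pi oc : seq 'I_N) : nat :=
  count (fun u => u.1 != u.2) (zip oc pi).

Definition dis (N : nat) (pi oc : seq 'I_N) : nat :=
  \sum_(u <- zip oc pi) `|(u.1 : nat) - (u.2 : nat)|%N.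

(* When [oc] is a permutation of the spots, entry [s] is the car in spot [s]. *)
Definition oc_inv (N : nat) (oc : seq 'I_N) : seq nat :=
  [seq index s oc | s <- enum 'I_N].

Definition des (c : seq nat) : nat :=
  count (fun i => nth 0 c i.+1 < nth 0 c i)%N (iota 0 (size c).-1).

Definition rlm (c : seq nat) : nat :=
  count (fun i => all (fun cj => cj < nth 0 c i)%N (drop i.+1 c))
        (iota 0 (size c)).

(* Law of independent coins, each showing [true] with probability [p].        *)
Definition coins_prob (R : realFieldType) (p : R) (m : nat)
    (coins : m.-tuple bool) : R :=
  \prod_(heads <- coins) (if heads then p else 1 - p).

Definition expect (R : realFieldType) (A : lmodType R) (p : R) (m : nat)
    (X : m.-tuple bool -> A) : A :=
  \sum_(coins : m.-tuple bool) coins_prob p coins *: X coins.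

(* The arguments x, y, z, w range over an arbitrary commutative R-algebra, so *)
(* that they may be taken to be scalars (A := R^o) or indeterminates.         *)
Definition P' (R : realFieldType) (A : comAlgType R) (p : R) (n : nat)
    (x y z w : A) : A :=
  \sum_(pi : n.-tuple 'I_n)
    expect p (fun coins =>
      if outcome pi coins is Some oc then
        x ^+ unl pi oc * y ^+ dis pi oc * z ^+ des (oc_inv oc)
          * w ^+ rlm (oc_inv oc)
      else 0).

Lemma P'_0 (R : realFieldType) (A : comAlgType R) (p : R) (x y z w : A) :
  P' p 0 x y z w = 1.
Proof.
rewrite /P' (big_pred1 [tuple]) => [|t]; last exact/esym/eqP/tuple0.
rewrite /expect (big_pred1 [tuple]) => [|t]; last exact/esym/eqP/tuple0.
have inv0 : oc_inv ([::] : seq 'I_0) = [::].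
  by apply/nilP; rewrite /nilp /oc_inv size_map size_enum_ord.
by rewrite /coins_prob /dis /= inv0 !big_nil !expr0 !mulr1 scale1r.
Qed.

(* Main.v *)
(* Fix the outcome, and let c be the inverse permutation, so that spot b is    *)
(* taken by car c_b.  At that time exactly the spots holding an entry smaller  *)
(* than c_b are occupied, so the total weight of the pairs (preference, coin)  *)
(* sending this car to b is                                                    *)
(*   g(l, r) = 1 + p (xy + ... + xy^l) + (1 - p) (xy + ... + xy^r),            *)
(* with l and r the lengths of the runs of smaller entries just before and     *)
(* just after c_b.  Hence P'_n is the sum, over the permutations c, of         *)
(* (prod_b g(l_b, r_b)) z^des(c) w^rlm(c).  Writing c = s n t around its       *)
(* maximum n, no run crosses n, whose own factor is g(|s|, |t|); the weight    *)
(* factors through s and t and depends only on their relative orders, and      *)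
(* summing over the set of entries of s gives the recurrence.                  *)

Require Import Defs.
From mathcomp Require Import all_boot all_order all_algebra.
From mathcomp Require Import ring zify.

Import GRing.Theory.

(** Summing over preferences and coins with the outcome fixed turns [P'] into a sum over outcomes,
    since [unl] and [dis] add up car by car ([sum_parkings]). When the car of spot b arrives, the
    occupied spots are those whose entry in c = [oc_inv oc] is smaller than c_b. A preference at
    distance k > 0 on the left leads to b exactly when the k entries just before c_b are all smaller
    and the coin shows forward; on the right it is the same with backward. So the car contributes
    [run_factor l r] ([spot_weight_runs]), and [P'] is the sum of [perm_weight] over all
    permutations c ([P'_perm_sum]).

    The maximum of c cuts every run, gives a descent unless it is last, and hides everything before
    it from [rlm]; hence the weight factors around it ([perm_weight_cat_max]). Each block counts
    only through its relative order ([perm_sum_sorted]), and choosing the i entries to the left of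
    the maximum gives the binomial coefficient ([perm_sum_iotaS]). *)

Lemma leq_findP (T : Type) (t0 : T) (a : pred T) (l : seq T) k :
  k <= size l ->
  reflect (forall i, i < k -> ~~ a (nth t0 l i)) (k <= find a l).
Proof.
move=> kl; apply: (iffP idP) => [kf i ik|H].
  by apply/negbT/before_find/(leq_trans ik).
rewrite leqNgt; apply/negP => fk.
have fl : find a l < size l by apply: leq_trans kl.
by have := H _ fk; rewrite nth_find // has_find.
Qed.

Lemma find_cat_top a s v t :
  (a <= v) -> find (leq a) (s ++ v :: t) = find (leq a) s.
Proof.
move=> av; rewrite find_cat /= av addn0; case: ifP => // /negbT.
by rewrite has_find -leqNgt => ?; apply/eqP; rewrite eqn_leq find_size andbT.
Qed.

Lemma find_below v s : all (fun a => a < v) s -> find (leq v) s = size s.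
Proof.
move=> sv; apply/hasNfind; rewrite -all_predC.
by apply: sub_all sv => a /=; rewrite -ltnNge.
Qed.

(** Filtering keeps the order, so the head of the filtered list is its [r]-least element. The
    relation is left general to serve both the enumeration of the spots and its reversal. *)
Lemma ohead_filter_sorted (T : eqType) (r : rel T) (a : pred T) (l : seq T) (b : T) :
  transitive r -> irreflexive r -> {in l &, forall u v, u != v -> r u v || r v u} ->
  sorted r l -> b \in l ->
  (ohead (filter a l) == Some b) = a b && all (fun u => r u b ==> ~~ a u) l.
Proof.
move=> rtr rirr; elim: l => [|u l IH] // rtot /=.
rewrite (path_sortedE rtr) => /andP[/allP ru l_sorted].
rewrite inE; case: ifP => au /= bl.
  rewrite (inj_eq Some_inj) implybF; apply/eqP/andP => [<-|[ab]].
    split=> //; rewrite rirr /=; apply/allP => v /ru uv; apply/implyP => vu.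
    by have := rirr u; rewrite (rtr _ _ _ uv vu).
  by case/andP=> nub _; case/orP: bl => [/eqP //|/ru ub]; rewrite ub in nub.
case/orP: bl => [/eqP ->|bl]; last first.
  by rewrite implybT /= IH // => v w vl wl; apply: rtot; rewrite inE (vl, wl) orbT.
rewrite au /=; apply/eqP => ohead_u.
suff : u \in [seq v <- l | a v] by rewrite mem_filter au.
by case: (filter a l) ohead_u => //= v l' [->]; apply: mem_head.
Qed.

(** * Descents and right-to-left maxima around a maximum and under increasing maps *)

Lemma des_cons2 a b c : des [:: a, b & c] = (b < a) + des (b :: c).
Proof. by rewrite /des /= (iotaDl 1 0) count_map. Qed.

Lemma rlm_cons a c : rlm (a :: c) = all (fun cj => cj < a) c + rlm c.
Proof. by rewrite /rlm /= drop0 (iotaDl 1 0) count_map. Qed.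

Lemma des_cat_max s v t :
  all (fun a => a < v) s -> all (fun a => a < v) t ->
  des (s ++ v :: t) = des s + (t != [::]) + des t.
Proof.
move=> + tv; elim: s => [_|a [|b s] IH] /=.
- by case: t tv => [|b t] //= /andP[bv _]; rewrite des_cons2 bv.
- by case/andP=> av _; rewrite des_cons2 IH // ltnNge ltnW.
- by case/andP=> av sv; rewrite 2!des_cons2 -cat_cons IH // !addnA.
Qed.

Lemma rlm_cat_max s v t :
  all (fun a => a < v) s -> all (fun a => a < v) t ->
  rlm (s ++ v :: t) = (rlm t).+1.
Proof.
move=> + tv; elim: s => [_|a s IH] /=; first by rewrite rlm_cons tv.
case/andP=> av sv; rewrite rlm_cons IH // all_cat /= (ltnNge v) (ltnW av).
by rewrite andbF.
Qed.

Lemma des_map f c :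
  {in c &, {mono f : a b / a < b}} -> des [seq f a | a <- c] = des c.
Proof.
elim: c => [|a [|b c] IH] // fmono.
rewrite 2!map_cons 2!des_cons2 -map_cons IH.
  by rewrite fmono ?inE ?eqxx ?orbT.
by move=> u v uc vc; apply: fmono; rewrite inE (uc, vc) orbT.
Qed.

Lemma rlm_map f c :
  {in c &, {mono f : a b / a < b}} -> rlm [seq f a | a <- c] = rlm c.
Proof.
elim: c => [|a c IH] // fmono; rewrite map_cons !rlm_cons IH => [|u v uc vc].
  congr (_ + _); rewrite all_map; congr (nat_of_bool _).
  by apply: eq_in_all => u uc /=; rewrite fmono ?inE ?uc ?eqxx ?orbT.
by apply: fmono; rewrite inE (uc, vc) orbT.
Qed.

Local Open Scope ring_scope.

Lemma big_tuple_cons (T : finType) (V : nmodType) m (F : m.+1.-tuple T -> V) :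
  \sum_(t : m.+1.-tuple T) F t =
    \sum_(a : T) \sum_(t : m.-tuple T) F (cons_tuple a t).
Proof.
rewrite pair_big /=; apply: (reindex (fun u : T * m.-tuple T => cons_tuple u.1 u.2)).
exists (fun t => (thead t, behead_tuple t)) => [[a t] _|t _] /=.
  by congr pair; apply: val_inj.
by case/tupleP: t => a t; apply: val_inj.
Qed.

(** * Weights of permutations *)

Section RunWeight.
Context {A : comNzRingType} (g : nat -> nat -> A).

(* The entry [a] contributes [g l r], where [l] (resp. [r]) is the length of  *)
(* the maximal run of entries smaller than [a] just before (resp. after) it.  *)
(* The list [pre] holds, in reverse order, what precedes [c].                 *)
Fixpoint run_weight (pre c : seq nat) : A :=
  if c is a :: c' then
    g (find (leq a) pre) (find (leq a) c') * run_weight (a :: pre) c'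
  else 1.

Lemma run_weight_cat_pre pre v q c :
  all (fun a => a < v)%N c ->
  run_weight (pre ++ v :: q) c = run_weight pre c.
Proof.
elim: c pre => [|a c IH] pre //= /andP[av cv].
by rewrite -cat_cons IH // find_cat_top // ltnW.
Qed.

(** The run to the left of [v] is all of [pre] and [s], and the one to its right all of [t]. No run
    of another entry crosses [v], so [t] is weighed as if nothing preceded it. *)
Lemma run_weight_cat_max pre s v t :
  all (fun a => a < v)%N pre -> all (fun a => a < v)%N s ->
  all (fun a => a < v)%N t ->
  run_weight pre (s ++ v :: t) =
    g (size pre + size s)%N (size t) * run_weight pre s * run_weight [::] t.
Proof.
move=> + + tv; elim: s pre => [|a s IH] pre prev /=.
  rewrite !find_below // addn0 mulr1 => _.
  by rewrite (run_weight_cat_pre [::]).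
case/andP=> av sv; rewrite IH //= ?av // find_cat_top 1?ltnW // addSnnS.
by rewrite -!mulrA [RHS]mulrCA; congr (_ * _); rewrite mulrCA.
Qed.

Lemma run_weight_map f pre c :
  {in pre ++ c &, {mono f : a b / a < b}%N} ->
  run_weight [seq f a | a <- pre] [seq f a | a <- c] = run_weight pre c.
Proof.
elim: c pre => [|a c IH] pre //= fmono.
have perm_pre : a :: pre ++ c =i pre ++ a :: c.
  by move=> u; rewrite inE !mem_cat inE orbCA.
rewrite -map_cons IH => [|u v uc vc]; last first.
  by apply: fmono; rewrite -perm_pre.
congr (g _ _ * _); rewrite find_map; apply: eq_in_find => u uc /=;
  by rewrite [LHS]leqNgt fmono -?leqNgt // mem_cat ?inE ?uc ?eqxx ?orbT.
Qed.

(** Positions of [c] will be spots: this form is compared with the product of the spot weights. *)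
Lemma run_weight_prod pre c :
  run_weight pre c = \prod_(i < size c)
    g (find (leq (nth 0%N c i)) (rev (take i c) ++ pre))
      (find (leq (nth 0%N c i)) (drop i.+1 c)).
Proof.
elim: c pre => [|a c IH] pre; first by rewrite big_ord0.
rewrite big_ord_recl /= drop0 IH; congr (_ * _).
by apply: eq_bigr => i _; rewrite rev_cons cat_rcons.
Qed.

End RunWeight.

(** * Sums of weights over all permutations of a list *)

Section PermSum.
Context {A : comNzRingType} (g : nat -> nat -> A) (z : A).

Definition perm_weight (w : A) (c : seq nat) : A :=
  run_weight g [::] c * z ^+ des c * w ^+ rlm c.

Definition perm_sum (w : A) (s : seq nat) : A :=
  \sum_(c <- permutations s) perm_weight w c.

Lemma perm_weight_cat_max w s v t :
  all (fun a => a < v)%N s -> all (fun a => a < v)%N t ->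
  perm_weight w (s ++ v :: t) =
    g (size s) (size t) * z ^+ (t != [::]) * w
      * perm_weight 1 s * perm_weight w t.
Proof.
move=> sv tv; rewrite /perm_weight run_weight_cat_max // des_cat_max //.
rewrite rlm_cat_max // add0n !exprD exprS expr1n mulr1.
by ring.
Qed.

Lemma perm_weight_map w f c :
  {in c &, {mono f : a b / a < b}%N} ->
  perm_weight w [seq f a | a <- c] = perm_weight w c.
Proof.
move=> fmono.
by rewrite /perm_weight (run_weight_map g f [::]) // des_map // rlm_map.
Qed.

(** The weight sees only comparisons, and [nth 0 s] is an increasing bijection from the positions of
    [s] to its entries. *)
Lemma perm_sum_sorted w s :
  sorted ltn s -> perm_sum w s = perm_sum w (iota 0 (size s)).
Proof.
move=> s_sorted; set r := iota 0 (size s).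
have s_uniq : uniq s by apply: sorted_uniq s_sorted; [apply: ltn_trans | apply: ltnn].
have sE : [seq nth 0%N s i | i <- r] = s by apply: mkseq_nth.
have rP i : i \in r = (i < size s)%N by rewrite mem_iota.
have nthK c : {subset c <= r} -> [seq index a s | a <- [seq nth 0%N s i | i <- c]] = c.
  move=> cr; rewrite -map_comp; apply: map_id_in => i /cr.
  by rewrite rP /= => ?; rewrite index_uniq.
have permsP : perm_eq (permutations s)
    [seq [seq nth 0%N s i | i <- c] | c <- permutations r].
  apply: uniq_perm; rewrite ?permutations_uniq //.
    rewrite map_inj_in_uniq ?permutations_uniq // => c d.
    rewrite !mem_permutations => /perm_mem cr /perm_mem dr cd.
    by rewrite -(nthK c) ?cd ?nthK // => i; rewrite (cr, dr).
  move=> c; rewrite mem_permutations; apply/idP/mapP => [cs|[d]]; last first.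
    by rewrite mem_permutations => dr ->; rewrite -{2}sE perm_map.
  exists [seq index a s | a <- c].
    rewrite mem_permutations -(nthK r) // sE; exact: perm_map.
  rewrite -map_comp; apply/esym/map_id_in => a ac /=.
  by rewrite nth_index // -(perm_mem cs).
rewrite /perm_sum (perm_big _ permsP) big_map.
apply: eq_big_seq => c; rewrite mem_permutations => /perm_mem cr.
apply: perm_weight_map => i j; rewrite !cr !rP => ilt jlt.
have nth_lt k l : (k < size s -> l < size s -> k < l -> nth 0 s k < nth 0 s l)%N.
  by move=> *; apply: (sorted_ltn_nth ltn_trans).
case: (ltngtP i j) => [ij|ji|->]; [exact: nth_lt | | exact: ltnn].
by apply/negbTE; rewrite -leqNgt ltnW ?nth_lt.
Qed.

(** Entries are naturals, so that lists of them can be joined around [n], which is not in ['I_n]. *)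
Definition labels n (U : {set 'I_n}) : seq nat := [seq val i | i <- enum U].

(** [U] is the set of entries standing before the maximum [n]. *)
Lemma permutations_split_max n :
  perm_eq (permutations (iota 0 n.+1))
    [seq st.1 ++ n :: st.2 | U <- enum {set 'I_n},
       st <- [seq (s, t) | s <- permutations (labels n U),
                           t <- permutations (labels n (~: U))]].
Proof.
have memL U (i : 'I_n) : (val i \in labels n U) = (i \in U).
  by rewrite mem_map ?mem_enum //; exact: val_inj.
have ltL U a : a \in labels n U -> (a < n)%N.
  by case/mapP => i _ ->; exact: ltn_ord.
have uniqL U : uniq (labels n U).
  by rewrite map_inj_uniq ?enum_uniq //; exact: val_inj.
have splitE s t :
    perm_eq (s ++ n :: t) (iota 0 n.+1) = perm_eq (s ++ t) (iota 0 n).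
  have -> : iota 0 n.+1 = iota 0 n ++ [:: n] by rewrite -addn1 iotaD.
  rewrite perm_catC /= perm_sym perm_catC /= perm_cons perm_sym.
  by rewrite perm_catC.
apply: uniq_perm; rewrite ?permutations_uniq //.
  apply: (@allpairs_uniq_dep _ (fun=> (seq nat * seq nat)%type)).
    exact: enum_uniq.
    move=> U _; apply: allpairs_uniq; rewrite ?permutations_uniq //.
    by move=> [? ?] [? ?].
  move=> ? ? /allpairsPdep[U [_ [_ /allpairsP[[s t] /= [sU _ ->]] ->]]].
  move=> /allpairsPdep[V [_ [_ /allpairsP[[s' t'] /= [sV _ ->]] ->]]] /=.
  move: sU sV; rewrite !mem_permutations => /perm_mem sU /perm_mem sV.
  have nL W : n \notin labels n W by apply/negP => /ltL; rewrite ltnn.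
  (* [n] is in neither [s] nor [s'], so its index is the length of the left block and the cut is
     determined. *)
  move=> eq_st; have szE : size s = size s'.
    have := congr1 (index n) eq_st; rewrite !index_cat sU sV !(negbTE (nL _)) /=.
    by rewrite eqxx !addn0.
  have /eqP := eq_st; rewrite eqseq_cat // => /andP[/eqP ss' /eqP[tt']].
  have -> : U = V by apply/setP => i; rewrite -!memL -sU -sV ss'.
  by rewrite ss' tt'.
move=> c; rewrite mem_permutations.
apply/idP/allpairsPdep; last first.
  case=> U [_ [_ /allpairsP[[s t] /= [sU tU ->]] ->]].
  rewrite !mem_permutations in sU tU.
  rewrite splitE; apply: (perm_trans (perm_cat sU tU)).
  apply: uniq_perm; rewrite ?iota_uniq //.
    rewrite cat_uniq !uniqL andbT /=; apply/hasPn => _ /mapP[i iU ->].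
    by rewrite memL; rewrite mem_enum inE in iU.
  move=> a; rewrite mem_cat mem_iota add0n leq0n /=; apply/orP/idP.
    by case=> /ltL.
  by move=> an; rewrite -[a]/(val (Ordinal an)) !memL inE; apply/orP/orbN.
move=> c_perm; have nc : n \in c by rewrite (perm_mem c_perm) mem_iota ltnSn.
case/splitPr: nc c_perm => s t.
rewrite splitE => st_perm.
have stP a : (a \in s) || (a \in t) = (a < n)%N.
  by rewrite -mem_cat (perm_mem st_perm) mem_iota.
have : uniq (s ++ t) by rewrite (perm_uniq st_perm) iota_uniq.
rewrite cat_uniq => /and3P[s_uniq /hasPn tNs t_uniq].
exists [set i : 'I_n | val i \in s], (s, t); split; rewrite ?mem_enum //.
apply/allpairsP; exists (s, t); split; rewrite //= mem_permutations;
  apply: uniq_perm => // a; apply/idP/idP.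
- move=> sa; have an : (a < n)%N by rewrite -stP sa.
  by rewrite -[a]/(val (Ordinal an)) memL inE.
- by case/mapP=> i; rewrite mem_enum inE => ? ->.
- move=> ta; have an : (a < n)%N by rewrite -stP ta orbT.
  by rewrite -[a]/(val (Ordinal an)) memL !inE; apply: tNs.
- case/mapP=> i; rewrite mem_enum !inE => /negbTE iNs ->.
  by have := stP i; rewrite iNs ltn_ord.
Qed.

Lemma perm_sum_iotaS w n :
  perm_sum w (iota 0 n.+1) = \sum_(i < n.+1) 'C(n, i)%:R *
    (g i (n - i)%N * z ^+ (i < n)%N * w
       * perm_sum 1 (iota 0 i) * perm_sum w (iota 0 (n - i))).
Proof.
have labels_sorted (U : {set 'I_n}) : sorted ltn (labels n U).
  rewrite /labels sorted_map {1}/enum_mem -enumT.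
  apply: sorted_filter => [a b c|]; first exact: ltn_trans.
  by rewrite -sorted_map val_enum_ord iota_ltn_sorted.
have size_labels (U : {set 'I_n}) : size (labels n U) = #|U|.
  by rewrite size_map -cardE.
have card_le (U : {set 'I_n}) : (#|U| <= n)%N.
  by rewrite -[leqRHS]card_ord max_card.
have card_setC (U : {set 'I_n}) : #|~: U| = (n - #|U|)%N.
  by have := cardsC U; rewrite card_ord; lia.
pose T i := g i (n - i)%N * z ^+ (i < n)%N * w
       * perm_sum 1 (iota 0 i) * perm_sum w (iota 0 (n - i)).
(* The contribution of a set of left entries depends only on its cardinality. *)
transitivity (\sum_(U : {set 'I_n}) T #|U|).
  rewrite /perm_sum (perm_big _ (permutations_split_max n)) /=.
  rewrite big_allpairs_dep /= big_enum; apply: eq_bigr => U _.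
  have sumL v (V : {set 'I_n}) :
      perm_sum v (iota 0 #|V|) = perm_sum v (labels n V).
    by rewrite (perm_sum_sorted _ _ (labels_sorted V)) size_labels.
  rewrite /T -card_setC !sumL big_allpairs /=.
  rewrite /perm_sum [X in _ = X * _]mulr_sumr mulr_suml.
  apply: eq_big_seq => s; rewrite mem_permutations => sU.
  rewrite mulr_sumr; apply: eq_big_seq => t; rewrite mem_permutations => tU.
  rewrite perm_weight_cat_max.
  - rewrite (perm_size sU) (perm_size tU) !size_labels; do 4 congr (_ * _).
    rewrite -size_eq0 (perm_size tU) size_labels card_setC subn_eq0 -ltnNge //.
  - apply/allP => a; rewrite (perm_mem sU) => /mapP[i _ ->]; exact: ltn_ord.
  - apply/allP => a; rewrite (perm_mem tU) => /mapP[i _ ->]; exact: ltn_ord.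
(* Subsets are grouped by size; [inord] loses nothing because [#|U| <= n]. *)
rewrite (partition_big (fun U : {set 'I_n} => inord #|U| : 'I_n.+1) xpredT) //=.
apply: eq_bigr => i _; rewrite -/(T i).
transitivity (\sum_(U in [set U : {set 'I_n} | #|U| == i]) T i).
  apply: eq_big => [U|U].
    by rewrite inE -val_eqE /= inordK // ltnS.
  by move=> /eqP <-; rewrite inordK // ltnS.
by rewrite sumr_const card_draws card_ord mulr_natl.
Qed.

End PermSum.

(** * From parking outcomes to permutations *)

Section Parking.
Context {R : realFieldType} {A : comAlgType R} (p : R) (x y : A) (N : nat).
Implicit Types (occ : {set 'I_N}) (b s pref : 'I_N) (oc : seq 'I_N).

Definition coin_prob (heads : bool) : R := if heads then p else 1 - p.

Definition spot_weight occ b : A :=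
  \sum_(pref : 'I_N) \sum_(heads : bool)
    if park_car occ pref heads == Some b then
      coin_prob heads *: (x ^+ (b != pref) * y ^+ `|(b : nat) - pref|%N)
    else 0.

Fixpoint spots_weight occ oc : A :=
  if oc is b :: oc' then spot_weight occ b * spots_weight (b |: occ) oc'
  else 1.

(** Induction on the first car. [K] is arbitrary so that, once this car has parked in [b], the
    remaining cars are handled with [fun oc => K (b :: oc)]. *)
Lemma sum_parkings m occ (K : seq 'I_N -> A) :
  \sum_(pi : m.-tuple 'I_N) expect p (fun coins : m.-tuple bool =>
     if park_cars occ (zip pi coins) is Some oc then
       x ^+ unl pi oc * y ^+ dis pi oc * K oc
     else 0)
  = \sum_(oc : m.-tuple 'I_N) spots_weight occ oc * K oc.
Proof.
elim: m occ K => [|m IH] occ K.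
  do 2 ![rewrite (big_pred1 [tuple]) => [|t]; last exact/esym/eqP/tuple0].
  rewrite /expect (big_pred1 [tuple]) => [|t]; last exact/esym/eqP/tuple0.
  by rewrite /coins_prob /dis /= !big_nil !mul1r scale1r.
rewrite !big_tuple_cons.
pose G b := \sum_(oc : m.-tuple 'I_N) spots_weight (b |: occ) oc * K (b :: oc).
transitivity (\sum_(b : 'I_N) spot_weight occ b * G b); last first.
  apply: eq_bigr => b _; rewrite mulr_sumr; apply: eq_bigr => oc _ /=.
  by rewrite mulrA.
(* The sum over [b] is moved inside: a given preference and coin reach at most one spot. *)
under [RHS]eq_bigr => b _ do
  [rewrite mulr_suml; under eq_bigr => pref _ do rewrite mulr_suml].
rewrite [RHS]exchange_big /=; apply: eq_bigr => pref _.
rewrite [RHS]exchange_big /= /expect.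
under eq_bigr => pi _ do rewrite big_tuple_cons.
rewrite exchange_big /=; apply: eq_bigr => heads _.
case: (park_car _ _ _) => [b0|]; last first.
  rewrite big1 => [|pi _]; last by rewrite big1 // => coins _; rewrite scaler0.
  by rewrite big1 // => b _; rewrite mul0r.
rewrite [RHS](bigD1 b0) //= eqxx [X in _ = _ + X]big1 ?addr0; last first.
  by move=> b bb0; rewrite (inj_eq Some_inj) eq_sym (negbTE bb0) mul0r.
rewrite /G -(IH _ (fun oc => K (b0 :: oc))) mulr_sumr; apply: eq_bigr => pi _.
rewrite /expect mulr_sumr. apply: eq_bigr => coins _.
rewrite /coins_prob big_cons -/(coin_prob heads).
case: (park_cars _ _) => [oc|] /=; last by rewrite !scaler0 mulr0.
rewrite /unl /dis /= big_cons !exprD -!scalerAl -!scalerAr scalerA /=.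
by congr (_ *: _); rewrite !mulrA; congr (_ * _); ring.
Qed.

(** * Preferences and coins leading to a given spot *)

Lemma park_car_free occ pref heads b : park_car occ pref heads = Some b -> b \notin occ.
Proof.
have ohead_mem (s : seq 'I_N) : ohead s = Some b -> b \in s.
  by case: s => //= v s [->]; apply: mem_head.
rewrite /park_car; case: ifP => [free [<-] //|_].
by case: heads => /ohead_mem; rewrite ?mem_rev mem_filter => /andP[/andP[]].
Qed.

Lemma park_car_forward occ pref b :
  pref \in occ -> b \notin occ ->
  (park_car occ pref true == Some b) =
    (pref < b)%N && [forall s : 'I_N, (pref < s < b)%N ==> (s \in occ)].
Proof.
move=> pref_occ b_free; rewrite /park_car pref_occ /=.
rewrite (@ohead_filter_sorted _ (fun s t : 'I_N => s < t)%N).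
- rewrite b_free andbT; congr (_ && _).
  apply/allP/forallP => [H s|H s _]; apply/implyP; last first.
    by move=> sb; rewrite negb_and negbK; have := H s; rewrite sb andbT; case: (_ < _)%N.
  by case/andP=> ps sb; have := H s (mem_enum _ _); rewrite ps sb /= negbK.
- by move=> s t u; apply: ltn_trans.
- by move=> s; apply: ltnn.
- by move=> s t _ _; rewrite neq_ltn.
- by have := iota_ltn_sorted 0 N; rewrite -val_enum_ord sorted_map.
- by rewrite mem_enum.
Qed.

Lemma park_car_backward occ pref b :
  pref \in occ -> b \notin occ ->
  (park_car occ pref false == Some b) =
    (b < pref)%N && [forall s : 'I_N, (b < s < pref)%N ==> (s \in occ)].
Proof.
move=> pref_occ b_free; rewrite /park_car pref_occ /= -filter_rev.
rewrite (@ohead_filter_sorted _ (fun s t : 'I_N => t < s)%N).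
- rewrite b_free andbT; congr (_ && _).
  apply/allP/forallP => [H s|H s _]; apply/implyP; last first.
    by move=> sb; rewrite negb_and negbK; have := H s; rewrite sb; case: (_ < _)%N.
  by case/andP=> bs sp; have := H s; rewrite mem_rev mem_enum bs sp /= negbK; apply.
- by move=> s t u ts ut; apply: ltn_trans ts.
- by move=> s; apply: ltnn.
- by move=> s t _ _; rewrite neq_ltn orbC.
- rewrite rev_sorted.
  by have := iota_ltn_sorted 0 N; rewrite -val_enum_ord sorted_map.
- by rewrite mem_rev mem_enum.
Qed.

Lemma spot_weight_occupied occ b : b \in occ -> spot_weight occ b = 0.
Proof.
move=> b_occ; rewrite /spot_weight big1 // => pref _; rewrite big1 // => heads _.
by case: eqP => // /park_car_free; rewrite b_occ.
Qed.

(** Some car would have to take an occupied spot, and its factor vanishes. This reduces the sum over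
    all tuples to injective ones. *)
Lemma spots_weight_eq0 occ oc :
  ~~ (uniq oc && all (fun b => b \notin occ) oc) -> spots_weight occ oc = 0.
Proof.
elim: oc occ => [|b oc IH] occ //=.
case: (boolP (b \in occ)) => [/spot_weight_occupied -> _|_]; first by rewrite mul0r.
move=> H; rewrite IH ?mulr0 //; apply: contra H => /andP[-> /allP H] /=.
rewrite andbT; apply/andP; split; first by apply/negP => /H; rewrite !inE eqxx.
by apply/allP => s /H; rewrite !inE negb_or => /andP[].
Qed.

(** The term 1 is the preference for the spot itself, where both coins succeed and p + (1 - p) =
    1. *)
Definition run_factor (l r : nat) : A :=
  1 + p *: (\sum_(1 <= k < l.+1) x * y ^+ k)
    + (1 - p) *: (\sum_(1 <= k < r.+1) x * y ^+ k).

(** * Occupied spots as smaller entries, and the runs around a spot *)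

Section Smaller.
Context (c : seq nat) (b : 'I_N) (size_c : size c = N).
Let m := nth 0%N c b.
Let occ := [set s : 'I_N | nth 0 c s < m]%N.
Let l := find (leq m) (rev (take b c)).
Let r := find (leq m) (drop b.+1 c).

Let size_takeb : size (rev (take b c)) = b.
Proof. by rewrite size_rev size_takel // size_c ltnW. Qed.

Let size_dropb : size (drop b.+1 c) = (N - b.+1)%N.
Proof. by rewrite size_drop size_c. Qed.

Let b_free : b \notin occ. Proof. by rewrite inE ltnn. Qed.

(** The car reaches [b] exactly when [pref] and all spots between are occupied, that is, when the
    run of smaller entries before [b] extends back to [pref]. *)
Lemma forward_run pref :
  (pref < b)%N -> (park_car occ pref true == Some b) = (b - pref <= l)%N.
Proof.
move=> pb; transitivity ((pref \in occ)
    && [forall s : 'I_N, (pref < s < b)%N ==> (s \in occ)]).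
  case: (boolP (pref \in occ)) => p_occ; first by rewrite park_car_forward ?pb.
  by rewrite /park_car p_occ; apply/eqP => -[pb']; rewrite pb' ltnn in pb.
have le_size : (b - pref <= size (rev (take b c)))%N.
  by rewrite size_takeb leq_subr.
(* Read backwards from [b], spot [s] is at position [b - s - 1]. *)
have nthE s : (s < b)%N -> nth 0%N (rev (take b c)) (b - s.+1) = nth 0%N c s.
  move=> sb; have szt : size (take b c) = b by rewrite -size_rev size_takeb.
  by rewrite nth_rev szt ?nth_take; [congr nth; lia | lia | lia].
apply/andP/(leq_findP _ 0%N _ _ _ le_size) => [[p_occ /forallP H] i i_lt|H].
- have sN : (b - i.+1 < N)%N by have := ltn_ord b; lia.
  pose s := Ordinal sN; have sb : (s < b)%N by rewrite /=; lia.
  have -> : i = (b - s.+1)%N by rewrite /=; lia.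
  rewrite nthE // -ltnNge; case: (ltngtP pref s) => ps.
  + by have := H s; rewrite ps sb inE.
  + by exfalso; move: ps; rewrite /=; lia.
  + by rewrite -ps; rewrite inE in p_occ.
- have {}H (s : 'I_N) : (pref <= s < b)%N -> s \in occ.
    case/andP=> ps sb; rewrite inE ltnNge -nthE //; apply: H; lia.
  split; first by apply: H; rewrite leqnn.
  by apply/forallP => s; apply/implyP => /andP[ps sb]; rewrite H ?(ltnW ps).
Qed.

Lemma backward_run pref :
  (b < pref)%N -> (park_car occ pref false == Some b) = (pref - b <= r)%N.
Proof.
move=> bp; transitivity ((pref \in occ)
    && [forall s : 'I_N, (b < s < pref)%N ==> (s \in occ)]).
  case: (boolP (pref \in occ)) => p_occ; first by rewrite park_car_backward ?bp.
  by rewrite /park_car p_occ; apply/eqP => -[pb']; rewrite pb' ltnn in bp.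
have le_size : (pref - b <= size (drop b.+1 c))%N.
  by rewrite size_dropb; have := ltn_ord pref; lia.
have nthE s : (b < s)%N -> nth 0%N (drop b.+1 c) (s - b.+1) = nth 0%N c s.
  by move=> bs; rewrite nth_drop subnKC.
apply/andP/(leq_findP _ 0%N _ _ _ le_size) => [[p_occ /forallP H] i i_lt|H].
- have sN : (i + b.+1 < N)%N by have := ltn_ord pref; lia.
  pose s := Ordinal sN; have bs : (b < s)%N by rewrite /=; lia.
  have -> : i = (s - b.+1)%N by rewrite /=; lia.
  rewrite nthE // -ltnNge; case: (ltngtP pref s) => ps.
  + by exfalso; move: ps; rewrite /=; lia.
  + by have := H s; rewrite ps bs inE.
  + by rewrite -ps; rewrite inE in p_occ.
- have {}H (s : 'I_N) : (b < s <= pref)%N -> s \in occ.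
    case/andP=> bs sp; rewrite inE ltnNge -nthE //; apply: H; lia.
  split; first by apply: H; rewrite leqnn bp.
  by apply/forallP => s; apply/implyP => /andP[ps sb]; rewrite H ?(ltnW sb) ?ps.
Qed.

Lemma wrong_direction pref heads :
  (if heads then b < pref else pref < b)%N -> park_car occ pref heads != Some b.
Proof.
move=> wrong; apply/eqP.
have [p_occ|p_free] := boolP (pref \in occ); last first.
  rewrite /park_car p_free => -[pb].
  by move: wrong; rewrite pb ltnn; case: heads.
move/eqP; case: heads wrong => wrong.
  by rewrite park_car_forward // ltnNge (ltnW wrong).
by rewrite park_car_backward // ltnNge (ltnW wrong).
Qed.

Lemma spot_weight_runs : spot_weight occ b = run_factor l r.
Proof.
have l_le : (l <= b)%N by rewrite -[leqRHS]size_takeb find_size.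
have r_le : (r <= N - b.+1)%N by rewrite -size_dropb find_size.
have dist_l pref : (pref < b)%N -> `|(b : nat) - pref|%N = (b - pref)%N.
  by move=> ?; rewrite distnEl // ltnW.
have dist_r pref : (b < pref)%N -> `|(b : nat) - pref|%N = (pref - b)%N.
  by move=> ?; rewrite distnEr // ltnW.
(* Contributions of a preference at distance [k], to the left and to the right, made zero beyond the
   run. *)
pose f k : A := if (k <= l)%N then p *: (x * y ^+ k) else 0.
pose h k : A := if (k <= r)%N then (1 - p) *: (x * y ^+ k) else 0.
have own heads : park_car occ b heads = Some b by rewrite /park_car b_free.
rewrite /spot_weight (bigD1 b) //= big_bool /= !own !eqxx distnn.
rewrite !expr0 mul1r -scalerDl [p + _]addrC subrK scale1r /run_factor -addrA.
congr (1 + _).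
transitivity (\sum_(pref < N | (pref < b)%N) f (b - pref)%N
   + \sum_(pref < N | (b < pref)%N) h (pref - b)%N).
  rewrite (bigID (fun pref : 'I_N => pref < b)%N) /=; congr (_ + _).
    apply: eq_big => [pref|pref /andP[_ pb]]; first by rewrite -val_eqE /= neq_ltn; lia.
    rewrite big_bool /= (negbTE (wrong_direction pref false _)) //= addr0.
    by rewrite forward_run // dist_l // /f -val_eqE /= gtn_eqF.
  apply: eq_big => [pref|pref]; first by rewrite -val_eqE /= neq_ltn; lia.
  rewrite -val_eqE /= neq_ltn => /andP[/orP[->//|bp] _].
  rewrite big_bool /= (negbTE (wrong_direction pref true _)) //= add0r.
  by rewrite backward_run // dist_r // /h -val_eqE /= ltn_eqF.
congr (_ + _).
  (* Reversing the spots below [b] replaces each spot by its distance to [b] minus one. *)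
  rewrite (big_ord_narrow (ltnW (ltn_ord b))) /= (reindex_inj rev_ord_inj) /=.
  rewrite big_add1 big_mkord scaler_sumr.
  rewrite (big_ord_widen _ (fun k => p *: (x * y ^+ k.+1)) l_le) [RHS]big_mkcond /=.
  by apply: eq_bigr => k _; rewrite subKn.
rewrite -(big_geq_mkord b.+1 N xpredT (fun i => h (i - b)%N)).
rewrite -{1}[b.+1]add0n big_addn big_mkord big_add1 big_mkord scaler_sumr.
rewrite (big_ord_widen _ (fun k => (1 - p) *: (x * y ^+ k.+1)) r_le) [RHS]big_mkcond /=.
by apply: eq_bigr => k _; rewrite addnS -addSn addnK.
Qed.

End Smaller.

(** The spots filled before [b] are those of smaller index in [oc]; a spot missing from [oc] has
    index [size oc] and is never counted. *)
Lemma spots_weight_prod occ oc :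
  uniq oc -> spots_weight occ oc =
    \prod_(b <- oc) spot_weight (occ :|: [set s | index s oc < index b oc]%N) b.
Proof.
elim: oc occ => [|b oc IH] occ /=; first by rewrite big_nil.
case/andP=> b_oc oc_uniq; rewrite big_cons /= eqxx IH //; congr (_ * _).
  congr spot_weight; apply/setP => s; rewrite !inE; case: (b == s) => /=;
    by rewrite ?ltn0 orbF.
apply: eq_big_seq => s s_oc; congr spot_weight; apply/setP => u; rewrite !inE.
have -> : (b == s) = false by apply: contraNF b_oc => /eqP->.
by rewrite eq_sym; case: (b == u); rewrite ?orbT ?ltnS.
Qed.

Lemma size_oc_inv oc : size (oc_inv oc) = N.
Proof. by rewrite size_map size_enum_ord. Qed.

Lemma nth_oc_inv oc s : nth 0%N (oc_inv oc) s = index s oc.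
Proof. by rewrite (nth_map s) ?size_enum_ord // nth_ord_enum. Qed.

Lemma perm_enum_ord oc : uniq oc -> size oc = N -> perm_eq oc (enum 'I_N).
Proof.
move=> oc_uniq size_oc; apply: uniq_perm; rewrite ?enum_uniq //.
have [s _||_] := @uniq_min_size _ _ (enum 'I_N) oc_uniq; rewrite ?mem_enum //.
by rewrite size_enum_ord size_oc.
Qed.

Lemma spots_weight_oc_inv oc :
  uniq oc -> size oc = N ->
  spots_weight set0 oc = run_weight run_factor [::] (oc_inv oc).
Proof.
move=> oc_uniq size_oc; rewrite spots_weight_prod // run_weight_prod size_oc_inv.
rewrite (perm_big _ (perm_enum_ord _ oc_uniq size_oc)) big_enum /=.
apply: eq_bigr => b _; rewrite cats0 -spot_weight_runs ?size_oc_inv //; congr spot_weight.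
by apply/setP => s; rewrite !inE /= !nth_oc_inv.
Qed.

End Parking.

(** * Injective outcomes as permutations *)

Lemma oc_inv_perm n (oc : n.-tuple 'I_n) :
  uniq oc -> perm_eq (oc_inv oc) (iota 0 n).
Proof.
move=> oc_uniq; have := perm_enum_ord _ _ oc_uniq (size_tuple oc).
rewrite perm_sym => /(perm_map (index^~ oc))/perm_trans; apply.
suff -> : [seq index s oc | s <- oc] = iota 0 n by [].
apply: (@eq_from_nth _ 0%N) => [|i]; rewrite size_map size_tuple ?size_iota //.
move=> i_lt; have s0 := Ordinal i_lt.
by rewrite (nth_map s0) ?size_tuple // index_uniq ?size_tuple // nth_iota.
Qed.

Lemma oc_inv_inj n :
  {in [pred oc : n.-tuple 'I_n | uniq oc] &, injective (fun oc => oc_inv (tval oc))}.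
Proof.
move=> t t' t_uniq t'_uniq eq_inv; apply: val_inj => /=.
case: n t t' t_uniq t'_uniq eq_inv => [|n] t t' t_uniq t'_uniq eq_inv.
  by rewrite (tuple0 t) (tuple0 t').
apply: (@eq_from_nth _ ord0) => [|i]; rewrite !size_tuple // => i_lt.
have t'_full s : s \in (t' : seq _).
  by rewrite (perm_mem (perm_enum_ord _ _ t'_uniq (size_tuple t'))) mem_enum.
(* Both inverses give the spot [t_i] the same car, which is [i] according to [t]; hence [t'] also
   has [t_i] at position [i]. *)
rewrite -(nth_index ord0 (t'_full (nth ord0 t i))) -nth_oc_inv -eq_inv.
by rewrite nth_oc_inv index_uniq ?size_tuple.
Qed.

(** Inversion is injective into the permutations, and there are n! objects on both sides, so it is
    onto. *)
Lemma perm_oc_inv n :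
  perm_eq [seq oc_inv (tval oc) | oc <- enum [pred oc : n.-tuple 'I_n | uniq oc]]
    (permutations (iota 0 n)).
Proof.
have inv_uniq : uniq [seq oc_inv (tval oc)
    | oc <- enum [pred oc : n.-tuple 'I_n | uniq oc]].
  rewrite map_inj_in_uniq ?enum_uniq // => t t'.
  by rewrite !mem_enum; apply: oc_inv_inj.
apply: uniq_perm; rewrite ?permutations_uniq //.
have [_ /mapP[t t_uniq ->]||_] :=
  @uniq_min_size _ _ (permutations (iota 0 n)) inv_uniq => //.
  by rewrite mem_enum in t_uniq; rewrite mem_permutations oc_inv_perm.
rewrite size_permutations ?iota_uniq // size_iota size_map -cardE.
have := card_uniq_tuples n (predT : pred 'I_n).
rewrite card_ord ffactnn => <-; apply: subset_leq_card; apply/subsetP => t.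
by rewrite !inE => /andP[].
Qed.

Lemma P'_perm_sum (R : realFieldType) (A : comAlgType R) (p : R) n (x y z w : A) :
  P' p n x y z w = perm_sum (run_factor p x y) z w (iota 0 n).
Proof.
rewrite /perm_sum -(perm_big _ (perm_oc_inv n)) big_map big_enum /=.
pose K (oc : seq 'I_n) := z ^+ des (oc_inv oc) * w ^+ rlm (oc_inv oc).
transitivity (\sum_(oc : n.-tuple 'I_n) spots_weight p x y n set0 oc * K oc).
  rewrite -sum_parkings; apply: eq_bigr => pi _; apply: eq_bigr => coins _.
  rewrite /outcome; case: (park_cars _ _) => [oc|] //.
  by rewrite /K /= mulrA.
rewrite [RHS]big_mkcond /=; apply: eq_bigr => oc _.
have [oc_uniq|oc_nuniq] := boolP (uniq oc).
  by rewrite unfold_in /= oc_uniq spots_weight_oc_inv ?size_tuple // /perm_weight -mulrA.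
by rewrite unfold_in /= (negbTE oc_nuniq) spots_weight_eq0 ?mul0r // (negbTE oc_nuniq).
Qed.

Theorem theorem2p1 (R : realFieldType) (A : comAlgType R) (p : R)
    (hp : 0 <= p <= 1) (n : nat) (hn : (1 <= n)%N) (x y z w : A) :
  P' p n x y z w =
    (1 + p *: \sum_(1 <= k < n) x * y ^+ k) * w * P' p n.-1 x y z 1
    + \sum_(0 <= i < n.-1)
        'C(n.-1, i)%:R
        * (1 + p *: (\sum_(1 <= k < i.+1) x * y ^+ k)
             + (1 - p) *: (\sum_(1 <= k < n - i) x * y ^+ k))
        * z * w * P' p i x y z 1 * P' p (n - i - 1) x y z w.
Proof.
case: n hn => // n _; rewrite P'_perm_sum perm_sum_iotaS big_ord_recr /= addrC.
(* The top index is the case of the maximum in last place: the right block is empty, so there is no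
   descent, the backward sum vanishes and [P'_0] applies. *)
congr (_ + _).
  rewrite binn subnn ltnn -!P'_perm_sum P'_0 mul1r !mulr1 /run_factor.
  by rewrite [X in (1 - p) *: X]big_geq // scaler0 addr0.
rewrite big_mkord; apply: eq_bigr => i _.
by rewrite subSn ?subn1 ?(ltnW (ltn_ord i)) // ltn_ord -!P'_perm_sum !mulrA.
Qed.
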